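(* Let $\mathcal{H}$ be a complex separable Hilbert space, let $K$ be a bounded linear operator on $\mathcal{H}$ with closed range, let $m\in\mathbb{N}$ and $[m]=\{1,\dots,m\}$. Let $\big\{\{\phi_{ij}\}_{j=1}^\infty : i\in[m]\big\}$ be a family of $K$-frames for $\mathcal{H}$. The following are equivalent: (i) $\big\{\{\phi_{ij}\}_{j=1}^\infty : i\in[m]\big\}$ is $K$-woven. (ii) $\big\{\{U(\phi_{ij})\}_{j=1}^\infty : i\in[m]\big\}$ is $UK$-woven for all bounded linear operators $U$ on $\mathcal{H}$.
   Context: For a bounded linear operator $L$ on $\mathcal{H}$, a sequence $\{f_k\}_{k=1}^\infty\subset\mathcal{H}$ is an $L$-frame for $\mathcal{H}$ with lower bound $A>0$ and upper bound $B>0$ if $A\|L^*f\|^2\le\sum_{k=1}^\infty|\langle f,f_k\rangle|^2\le B\|f\|^2$ for all $f\in\mathcal{H}$. A family of $L$-frames $\big\{\{\phi_{ij}\}_{j=1}^\infty : i\in[m]\big\}$ is $L$-woven if there exist universal constants $A,B>0$ such that for every partition $\{\sigma_i\}_{i\in[m]}$ of $\mathbb{N}$ (pairwise disjoint, possibly empty, sets with union $\mathbb{N}$), the indexed family $\bigcup_{i\in[m]}\{\phi_{ij}\}_{j\in\sigma_i}$ is an $L$-frame for $\mathcal{H}$ with lower bound $A$ and upper bound $B$. These definitions are used with $L=K$ and $L=UK$; no closed-range requirement is imposed on $UK$. *)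

(* Defs.v *)
From HB Require Import structures.
From mathcomp Require Import all_boot all_order all_algebra.
From mathcomp Require Import all_classical all_reals all_analysis.
From mathcomp.real_closed Require Import complex.

Set Implicit Arguments.
Unset Strict Implicit.
Unset Printing Implicit Defensive.

Import Order.TTheory GRing.Theory Num.Theory.
Import numFieldNormedType.Exports.

Local Open Scope classical_set_scope.
Local Open Scope complex_scope.
Local Open Scope ring_scope.

Definition separable (T : topologicalType) : Prop :=
  exists2 D : set T, countable D & dense D.

Section Hilbert.
Context {R : realType} {H : completeNormedModType R[i]}.

(* A complex Hilbert space is a complete normed space over R[i] with an inner
   product, linear in its first argument, that induces the norm. *)
Definition induces_norm (dot : {dot H for Num.conj}) : Prop :=
  forall f : H, `|f| ^+ 2 = dot f f.

(* `|f| is an element of R[i] with zero imaginary part. *)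
Definition hnorm (f : H) : R := complex.Re `|f|.

Definition bounded_operator (L : {linear H -> H}) : Prop :=
  exists M : R, forall f : H, hnorm (L f) <= M * hnorm f.

Variable dot : {dot H for Num.conj}.

(* The value at g is the only h such that <L f, g> = <f, h> for all f; such an
   h exists for bounded L by the Riesz representation theorem, so the default
   value 0 is then irrelevant. *)
Definition adjoint (L : {linear H -> H}) (g : H) : H :=
  xget 0 [set h | forall f : H, dot (L f) g = dot f h].

(* The frame inequality for a family of vectors indexed by a set D: the terms
   are nonnegative, so the unordered sum over D = [set: nat] is the series. *)
Definition frame_bounds (L : {linear H -> H}) (T : choiceType) (D : set T)
    (phi : T -> H) (A B : R) : Prop :=
  forall f : H,
    ((A * hnorm (adjoint L f) ^+ 2)%:E
       <= \esum_(k in D) (Normc.normc (dot f (phi k)) ^+ 2)%:E)%E /\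
    (\esum_(k in D) (Normc.normc (dot f (phi k)) ^+ 2)%:E
       <= (B * hnorm f ^+ 2)%:E)%E.

Definition frame (L : {linear H -> H}) (phi : nat -> H) : Prop :=
  exists A B : R, [/\ 0 < A, 0 < B & frame_bounds L [set: nat] phi A B].

(* The union over i of the families (phi i j), j in sigma i, is indexed by the
   pairs (i, j) with j in sigma i, so that repeated vectors are counted with
   multiplicity. *)
Definition woven (L : {linear H -> H}) (m : nat) (phi : 'I_m -> nat -> H) :
    Prop :=
  (forall i, frame L (phi i)) /\
  exists A B : R, [/\ 0 < A, 0 < B &
    forall sigma : 'I_m -> set nat,
      trivIset [set: 'I_m] sigma ->
      \bigcup_(i in [set: 'I_m]) sigma i = [set: nat] ->
      frame_bounds L [set ij : 'I_m * nat | sigma ij.1 ij.2]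
        (fun ij => phi ij.1 ij.2) A B].

End Hilbert.

(* Main.v *)
Require Import Defs.
From HB Require Import structures.
From mathcomp Require Import all_boot all_order all_algebra.
From mathcomp Require Import all_classical all_reals all_analysis.
From mathcomp.real_closed Require Import complex.
From mathcomp Require Import ring lra.

Import Order.TTheory GRing.Theory Num.Theory.
Import numFieldNormedType.Exports.

Local Open Scope classical_set_scope.
Local Open Scope complex_scope.
Local Open Scope ring_scope.

(** The theorem is true because a bounded operator [U] can be moved to the other
    side of the inner product.  Since [<f, U phi_ij> = <U^* f, phi_ij>], the
    series of the family [U phi_ij] at [f] is the series of [phi_ij] at [U^* f],
    term by term and for every choice of the index set.  The two frame
    inequalities for [K] at [U^* f] then read
      [A |K^* U^* f|^2 <= series <= B |U^* f|^2],
    where [K^* U^* = (U K)^*] and [|U^* f| <= M |f|] as soon as [|U f| <= M |f|].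
    So the bounds [A] and [B M^2] serve [U K], and they are uniform over the
    partitions because [A] and [B] are; this is [frame_bounds_comp].  The
    converse is the case [U = id].

    What carries the argument is that adjoints exist ([adjointP]).  That is the
    Riesz representation theorem, proved here by the variational method: for a
    bounded functional [l], the quadratic functional [J f = |f|^2 - 2 Re (l f)]
    is bounded below, the parallelogram identity makes its minimizing sequences
    Cauchy, and their limit represents [l], the Euler-Lagrange equation of [J]
    being [Re <h, f> = Re (l f)]. *)

(** * A discriminant inequality *)

(** Evaluation at the vertex [- b / c]; when [c = 0] a nonzero slope [b] would
    make the affine function take the value [-1].  It yields both the
    Cauchy-Schwarz inequality and the first-order condition at an approximate
    minimum of a quadratic functional. *)
Lemma quad_ge0_discriminant (R : realFieldType) (a b c : R) : 0 <= c ->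
  (forall t, 0 <= a + 2 * t * b + t ^+ 2 * c) -> b ^+ 2 <= a * c.
Proof.
rewrite le_eqVlt => /orP[/eqP <-|c_gt0] quad_ge0.
  rewrite mulr0; have [->|b_neq0] := eqVneq b 0; first by rewrite expr0n.
  have := quad_ge0 (- (a + 1) / (2 * b)).
  have -> : a + 2 * (- (a + 1) / (2 * b)) * b
              + (- (a + 1) / (2 * b)) ^+ 2 * 0 = - 1 by field.
  by rewrite lerNr oppr0 ler10.
have := quad_ge0 (- b / c).
have -> : a + 2 * (- b / c) * b + (- b / c) ^+ 2 * c = (a * c - b ^+ 2) / c.
  by field; rewrite gt_eqF.
by rewrite pmulr_lge0 ?invr_gt0// subr_ge0.
Qed.

(** * The real inner product of a complex Hilbert space *)

Lemma Re_mulC (R : rcfType) (t : R) (z : R[i]) :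
  complex.Re (t%:C * z) = t * complex.Re z.
Proof. by case: z => a b; simpc. Qed.

Lemma Re_muliC (R : rcfType) (z : R[i]) :
  complex.Re ('i%C * z) = - complex.Im z.
Proof. by case: z => a b; simpc. Qed.

Section InnerProduct.
Context {R : realType} {H : completeNormedModType R[i]}.
Variable dot : {dot H for Num.conj}.
Hypothesis dot_norm : induces_norm dot.

(** The variational argument takes place in the underlying real Hilbert space,
    where minimization makes sense and real and imaginary parts need not be
    carried along; the complex form is recovered at the very end. *)
Definition re_dot (f g : H) : R := complex.Re (dot f g).

Lemma dot_conj (f g : H) : dot f g = (dot g f)^*%C.
Proof. by rewrite hermC expr0 mul1r. Qed.

Lemma re_dotC (f g : H) : re_dot f g = re_dot g f.
Proof. by rewrite /re_dot dot_conj; case: (dot g f). Qed.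

Lemma re_dotDl (f g h : H) : re_dot (f + g) h = re_dot f h + re_dot g h.
Proof. by rewrite /re_dot linearDl raddfD. Qed.

Lemma re_dotZl (t : R) (f g : H) : re_dot (t%:C *: f) g = t * re_dot f g.
Proof. by rewrite /re_dot linearZl_LR Re_mulC. Qed.

Lemma re_dotDr (f g h : H) : re_dot h (f + g) = re_dot h f + re_dot h g.
Proof. by rewrite !(re_dotC h) re_dotDl. Qed.

Lemma re_dotZr (t : R) (f g : H) : re_dot f (t%:C *: g) = t * re_dot f g.
Proof. by rewrite !(re_dotC f) re_dotZl. Qed.

Lemma normEhnorm (f : H) : `|f| = (hnorm f)%:C.
Proof. by rewrite /hnorm RRe_real// normr_real. Qed.

Lemma hnorm_ge0 (f : H) : 0 <= hnorm f.
Proof. by rewrite -lecR -normEhnorm normr_ge0. Qed.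

Lemma sqr_hnorm (f : H) : hnorm f ^+ 2 = re_dot f f.
Proof. by rewrite /re_dot -dot_norm normEhnorm -rmorphXn. Qed.

Lemma re_dot_ge0 (f : H) : 0 <= re_dot f f.
Proof. by rewrite -sqr_hnorm sqr_ge0. Qed.

Lemma sqr_re_dot_le (f g : H) : re_dot f g ^+ 2 <= re_dot f f * re_dot g g.
Proof.
apply: quad_ge0_discriminant; first exact: re_dot_ge0.
move=> t; have := re_dot_ge0 (f + t%:C *: g).
rewrite re_dotDl !re_dotDr !re_dotZl !re_dotZr (re_dotC g f).
by congr (0 <= _); ring.
Qed.

Lemma re_dot_le (f g : H) : re_dot f g <= hnorm f * hnorm g.
Proof.
have fg_ge0 : 0 <= hnorm f * hnorm g by rewrite mulr_ge0 ?hnorm_ge0.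
apply: le_trans (ler_norm _) _.
rewrite -(ler_pXn2r (n := 2)) ?nnegrE//.
by rewrite real_normK ?num_real// exprMn !sqr_hnorm sqr_re_dot_le.
Qed.

Lemma dot_inj (g h : H) : (forall f, dot f g = dot f h) -> g = h.
Proof.
move=> gh; apply/eqP; rewrite -subr_eq0 -(dnorm_eq0 dot).
by rewrite linearBr /= gh subrr.
Qed.

(** * The Riesz representation theorem *)

Section Riesz.
Variable l : {linear H -> R[i]^o}.
Variable M : R.
Hypothesis l_bounded : forall f, complex.Re (l f) <= M * hnorm f.

Let lr (f : H) : R := complex.Re (l f).

Let lrD f g : lr (f + g) = lr f + lr g.
Proof. by rewrite /lr raddfD raddfD. Qed.

Let lrZ t f : lr (t%:C *: f) = t * lr f.
Proof. by rewrite /lr linearZ Re_mulC. Qed.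

(** If [l f = <f, h>] then [J f = |f - h|^2 - |h|^2], so the representing vector
    can only be the minimizer of [J]. *)
Let J (f : H) : R := re_dot f f - 2 * lr f.

Let inf_J : R := inf (range J).

Let J_has_inf : has_inf (range J).
Proof.
split; first by exists (J 0), 0.
exists (- M ^+ 2) => _ [f _ <-]; rewrite /J -sqr_hnorm.
have := l_bounded f; rewrite -/(lr f) => lf.
have := sqr_ge0 (hnorm f - M); rewrite sqrrB => sq_ge0.
by lra.
Qed.

Let inf_J_le f : inf_J <= J f.
Proof. by apply: ge_inf; [exact: J_has_inf.2|exists f]. Qed.

(** Approximate Euler-Lagrange equation: along the line [f + t g] the functional
    [J] is a quadratic polynomial in [t], with linear coefficient
    [2 (Re <f, g> - Re (l g))], that stays above [J f - e].  The
    gradient of [J] at an almost minimal [f] is thus small, which passes to the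
    limit without any continuity argument for [J]. *)
Let J_near f (e : R) : J f <= inf_J + e ->
  forall g, (re_dot f g - lr g) ^+ 2 <= e * re_dot g g.
Proof.
move=> Jf g; apply: quad_ge0_discriminant; first exact: re_dot_ge0.
move=> t; have := inf_J_le (f + t%:C *: g).
rewrite /J re_dotDl !re_dotDr !re_dotZl !re_dotZr (re_dotC g f) lrD lrZ.
by move: Jf; rewrite /J; nra.
Qed.

(** The parallelogram identity gives
    [|f - g|^2 = 2 J f + 2 J g - 4 J ((f + g) / 2)], and the midpoint value is at
    least [inf_J]. *)
Let J_parallelogram f g (e : R) : J f <= inf_J + e -> J g <= inf_J + e ->
  hnorm (f - g) ^+ 2 <= 4 * e.
Proof.
move=> Jf Jg; have := inf_J_le ((2^-1)%:C *: (f + g)).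
rewrite sqr_hnorm -scaleN1r (_ : -1 = (-1)%:C :> R[i]); last first.
  by rewrite rmorphN1.
move: Jf Jg; rewrite /J !re_dotZl !re_dotZr !re_dotDl !re_dotDr.
rewrite !re_dotZl !re_dotZr (re_dotC g f) lrZ lrD.
by lra.
Qed.

(** A minimizing sequence [u] is Cauchy by [J_parallelogram]; the identity
    [Re <u n, f> = Re (l f)], true up to an error of order [n^(-1/2)] by
    [J_near], becomes exact in the limit.  Applying it to [f] and to ['i f]
    gives the real and the imaginary part of [l f = <f, h>]. *)
Lemma riesz_representation : exists h, forall f, l f = dot f h.
Proof.
have invS_gt0 n : 0 < (n.+1%:R : R)^-1 by rewrite invr_gt0.
have /choice[u u_min] n : exists f, J f <= inf_J + n.+1%:R^-1.
  have [_ [f _ <-] /ltW Jf] := inf_adherent (invS_gt0 n) J_has_inf.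
  by exists f.
have u_cauchy e : 0 < e -> \forall n \near \oo, forall k, (n <= k)%N ->
    hnorm (u n - u k) < e.
  move=> eps_gt0.
  have e4_gt0 : 0 < e ^+ 2 / 4 by rewrite divr_gt0 ?exprn_gt0.
  near=> n => k nk.
  rewrite -(ltr_pXn2r (n := 2)) ?nnegrE ?hnorm_ge0 ?(ltW eps_gt0)//.
  have un_le : J (u n) <= inf_J + n.+1%:R^-1 := u_min n.
  have uk_le : J (u k) <= inf_J + n.+1%:R^-1.
    apply: le_trans (u_min k) _.
    by rewrite lerD2l lef_pV2 ?posrE// ler_nat.
  apply: le_lt_trans (J_parallelogram _ _ _ un_le uk_le) _.
  rewrite mulrC -ltr_pdivlMr//.
  by near: n; exact: near_infty_natSinv_lt (PosNum e4_gt0).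
have u_cvg : cvg (u @ \oo).
  apply/cauchy_cvgP/cauchy_exP => e; rewrite ltcE/= => /andP[/eqP Ime Ree].
  have [n _ un] := u_cauchy _ Ree.
  exists (u n); exists n => // k /= nk.
  rewrite -ball_normE/= normEhnorm ltcE/= Ime eqxx/=.
  exact: (un n (leqnn n)).
pose h := lim (u @ \oo).
have re_dot_h f : re_dot h f = lr f.
  have u_h e : 0 < e -> \forall n \near \oo, hnorm (h - u n) < e.
    move=> eps_gt0; have epsC_gt0 : 0 < e%:C by rewrite ltcR.
    move/cvgrPdist_lt : u_cvg => /(_ _ epsC_gt0).
    by apply: filterS => n; rewrite normEhnorm ltcR.
  apply/eqP; rewrite -subr_eq0 -normr_le0; apply/ler_addgt0Pr => e eps_gt0.
  rewrite add0r; pose N := hnorm f; have N_ge0 : 0 <= N := hnorm_ge0 f.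
  have N2_gt0 : 0 < 2 * N + 1 by lra.
  (* The error is at most 2 d |f|; the +1 in d covers the case f = 0. *)
  pose d := e / (2 * N + 1); have d_gt0 : 0 < d by rewrite divr_gt0.
  have dN_ge0 : 0 <= d * N by rewrite mulr_ge0// ltW.
  have [n [hn dn]] : exists n, hnorm (h - u n) < d /\ n.+1%:R^-1 < d ^+ 2.
    have d2_gt0 : 0 < d ^+ 2 by rewrite exprn_gt0.
    near \oo => n; exists n; split; first by near: n; exact: u_h.
    by near: n; exact: near_infty_natSinv_lt (PosNum d2_gt0).
  have dist_un : `|re_dot (u n) f - lr f| <= d * N.
    rewrite -(ler_pXn2r (n := 2)) ?nnegrE//.
    rewrite real_normK ?num_real// exprMn sqr_hnorm.
    apply: le_trans (J_near _ _ (u_min n) f) _.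
    by rewrite ler_wpM2r ?re_dot_ge0 ?ltW.
  have dist_h : `|re_dot (h - u n) f| <= d * N.
    rewrite -(ler_pXn2r (n := 2)) ?nnegrE//.
    rewrite real_normK ?num_real// exprMn sqr_hnorm.
    apply: le_trans (sqr_re_dot_le _ _) _.
    rewrite ler_wpM2r ?re_dot_ge0// -sqr_hnorm.
    by rewrite ler_pXn2r ?nnegrE ?hnorm_ge0 ?ltW.
  have -> : re_dot h f - lr f
      = re_dot (h - u n) f + (re_dot (u n) f - lr f).
    by rewrite addrA -re_dotDl subrK.
  apply: le_trans (ler_normD _ _) _.
  apply: le_trans (lerD dist_h dist_un) _.
  have -> : e = d * (2 * N + 1) by rewrite /d divfK// gt_eqF.
  by lra.
exists h => f.
have re_eq g : complex.Re (l g) = complex.Re (dot g h).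
  by rewrite -/(re_dot g h) re_dotC re_dot_h.
(* Re (i z) = - Im z recovers the imaginary part. *)
apply/eqP; rewrite eq_complex re_eq eqxx /= -eqr_opp -!Re_muliC.
by rewrite -linearZl_LR -re_eq linearZ.
Unshelve. all: by end_near.
Qed.

End Riesz.

(** * Adjoints and frame bounds *)

(** By Cauchy-Schwarz the functional [f |-> <L f, g>] is bounded by [M |g|], so
    the Riesz theorem provides the vector that the adjoint selects. *)
Lemma adjointP (L : {linear H -> H}) : bounded_operator L ->
  forall f g, dot (L f) g = dot f (adjoint dot L g).
Proof.
move=> [M L_bounded] f g; move: f; rewrite /adjoint.
case: xgetP => [h _ //|no_adjoint]; exfalso.
pose l : H -> R[i]^o := fun f => dot (L f) g.
have l_linear : linear l.
  by move=> a x y; rewrite /l linearP linearPl.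
pose lL : {linear H -> R[i]^o} :=
  HB.pack l (GRing.isLinear.Build _ _ _ _ l l_linear).
have [f|h lh] := @riesz_representation lL (M * hnorm g).
  apply: le_trans (re_dot_le (L f) g) _.
  by rewrite mulrAC ler_wpM2r// hnorm_ge0.
exact: (no_adjoint h).
Qed.

Lemma adjoint_eq (L : {linear H -> H}) (g h : H) :
  (forall f, dot (L f) g = dot f h) -> adjoint dot L g = h.
Proof.
move=> Lgh; apply: dot_inj => f; rewrite -Lgh.
rewrite /adjoint; case: xgetP => [h' _ ->//|no_adjoint].
by have := no_adjoint h Lgh.
Qed.

Lemma adjoint_comp (U K : {linear H -> H}) :
  bounded_operator U -> bounded_operator K ->
  forall g, adjoint dot (U \o K) g = adjoint dot K (adjoint dot U g).
Proof.
move=> U_bounded K_bounded g; apply: adjoint_eq => f /=.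
by rewrite !adjointP.
Qed.

(** [|L^* f|^2 = <L L^* f, f> <= M |L^* f| |f|], then divide by [|L^* f|]. *)
Lemma hnorm_adjoint_le (L : {linear H -> H}) (M : R) :
  (forall f, hnorm (L f) <= M * hnorm f) ->
  forall f, hnorm (adjoint dot L f) <= M * hnorm f.
Proof.
move=> L_bounded f; set g := adjoint dot L f.
have [g0|g_neq0] := eqVneq (hnorm g) 0.
  by rewrite g0; apply: le_trans (L_bounded f); exact: hnorm_ge0.
have g_gt0 : 0 < hnorm g by rewrite lt_neqAle eq_sym g_neq0 hnorm_ge0.
rewrite -(ler_pM2r g_gt0) -expr2 sqr_hnorm /re_dot -adjointP; last by exists M.
apply: le_trans (re_dot_le (L g) f) _.
by rewrite mulrAC ler_wpM2r ?hnorm_ge0.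
Qed.

(** The index set [D] is arbitrary, so the lemma applies alike to a single
    frame and to the families obtained by weaving along a partition. *)
Lemma frame_bounds_comp (U K : {linear H -> H}) (M : R) (T : choiceType)
    (D : set T) (phi : T -> H) (A B : R) :
  bounded_operator K -> (forall f, hnorm (U f) <= M * hnorm f) -> 0 <= B ->
  frame_bounds dot K D phi A B ->
  frame_bounds dot (U \o K) D (U \o phi) A (B * M ^+ 2).
Proof.
move=> K_bounded U_le B_ge0 K_frame f.
have U_bounded : bounded_operator U by exists M.
have dotU k : dot f (U (phi k)) = dot (adjoint dot U f) (phi k).
  by rewrite dot_conj adjointP// -dot_conj.
under eq_esum do rewrite /= dotU.
rewrite adjoint_comp//; have [lower upper] := K_frame (adjoint dot U f).
split=> //; apply: le_trans upper _.
rewrite lee_fin -mulrA -exprMn ler_wpM2l//.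
have Uf_le : hnorm (adjoint dot U f) <= M * hnorm f by apply: hnorm_adjoint_le.
by rewrite ler_pXn2r ?nnegrE// ?hnorm_ge0// (le_trans (hnorm_ge0 _) Uf_le).
Qed.

End InnerProduct.

(** * The equivalence *)

Theorem proposition2p10 (R : realType) (H : completeNormedModType R[i])
    (dot : {dot H for Num.conj}) (dot_norm : induces_norm dot)
    (H_separable : separable H)
    (K : {linear H -> H}) (K_bounded : bounded_operator K)
    (K_closed_range : closed (range K))
    (m : nat) (m_gt0 : (0 < m)%N) (phi : 'I_m -> nat -> H)
    (phi_frame : forall i, frame dot K (phi i)) :
  woven dot K phi <->
  (forall U : {linear H -> H}, bounded_operator U ->
     woven dot (U \o K) (fun i j => U (phi i j))).
Proof.
split=> [[_ [A [B [A_gt0 B_gt0 K_woven]]]] U [M0 U_bounded]|UK_woven].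
  (* M0 may vanish (when U = 0), but the upper bound B * M ^+ 2 is positive. *)
  pose M := `|M0| + 1; have M_gt0 : 0 < M by rewrite ltr_wpDl.
  have U_le f : hnorm (U f) <= M * hnorm f.
    apply: le_trans (U_bounded f) _.
    rewrite ler_wpM2r ?hnorm_ge0// /M.
    by rewrite (le_trans (ler_norm M0))// lerDl.
  have M2_gt0 : 0 < M ^+ 2 by rewrite exprn_gt0.
  split=> [i|].
    have [Ai [Bi [Ai_gt0 Bi_gt0 phi_i]]] := phi_frame i.
    exists Ai, (Bi * M ^+ 2); split=> //; first by rewrite mulr_gt0.
    by apply: frame_bounds_comp => //; exact: ltW.
  exists A, (B * M ^+ 2); split=> //; first by rewrite mulr_gt0.
  move=> sigma sigma_disj sigma_cover.
  by apply: frame_bounds_comp => //; [exact: ltW|exact: K_woven].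
have id_bounded : bounded_operator (idfun : {linear H -> H}).
  by exists 1 => f; rewrite mul1r.
exact: (UK_woven _ id_bounded).
Qed.
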